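(* Let $G$ be the line graph of the subdivision graph of the square grid graph $P_m \Box P_n$ with $mn$ vertices. Then the F-index of $G$ is $F(G) = 256mn - 350m - 350n + 440$.
   Context: For a simple graph $H$, $d(u)$ denotes the degree of a vertex $u$ in $H$. The F-index of $H$ is $F(H) = \sum_{u \in V(H)} d^3(u) = \sum_{uv \in E(H)} [d^2(u)+d^2(v)]$. The subdivision graph $S(H)$ is the graph obtained from $H$ by inserting one additional vertex into each edge of $H$ (each edge is replaced by a path of length 2). The line graph $L(H)$ is the simple graph whose vertices are the edges of $H$, two distinct ones being adjacent when they share a common endpoint in $H$. $P_n$ is the path on $n$ vertices and $\Box$ is the Cartesian product of graphs.
   Formalization: The formal theorem assumes m, n ≥ 2; for m = 1 or n = 1 the grid is a path and the formula fails (for m = 1, n = 2 the F-index is 2, while the formula gives −98). *)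

(* Defs.v *)
From mathcomp Require Import all_boot.

Set Implicit Arguments.
Unset Strict Implicit.
Unset Printing Implicit Defensive.

Record sgraph := SGraph {
  vertex :> finType;
  adj : rel vertex;
  adj_sym : symmetric adj;
  adj_irr : irreflexive adj
}.

Definition degree (H : sgraph) (u : H) : nat := #|[set v : H | adj u v]|.

Definition F_index (H : sgraph) : nat := \sum_(u : H) degree u ^ 3.

(* Edges are the two-element vertex sets {u, v} with u adjacent to v
   (adj is irreflexive, so u and v are distinct). *)
Definition edges (H : sgraph) : {set {set H}} :=
  [set e | [exists u : H, exists v : H, adj u v && (e == [set u; v])]].

Definition edge (H : sgraph) : finType := {e : {set H} | e \in edges H}.

Section Subdivision.
Variable H : sgraph.

(* inl v is an original vertex; inr e is the new vertex inserted in e. *)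
Definition subdiv_adj (x y : (H + edge H)%type) : bool :=
  match x, y with
  | inl v, inr e => v \in val e
  | inr e, inl v => v \in val e
  | _, _ => false
  end.

Lemma subdiv_adj_sym : symmetric subdiv_adj.
Proof. by case=> [v|e] []. Qed.

Lemma subdiv_adj_irr : irreflexive subdiv_adj.
Proof. by case. Qed.

Definition subdivision_graph : sgraph := SGraph subdiv_adj_sym subdiv_adj_irr.

End Subdivision.

Section LineGraph.
Variable H : sgraph.

Definition line_adj (e f : edge H) : bool :=
  (e != f) && [exists v : H, (v \in val e) && (v \in val f)].

Lemma line_adj_sym : symmetric line_adj.
Proof.
move=> e f; rewrite /line_adj eq_sym; congr (_ && _).
by apply: eq_existsb => v; rewrite andbC.
Qed.

Lemma line_adj_irr : irreflexive line_adj.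
Proof. by move=> e; rewrite /line_adj eqxx. Qed.

Definition line_graph : sgraph := SGraph line_adj_sym line_adj_irr.

End LineGraph.

Section PathGraph.
Variable n : nat.

Definition path_adj (i j : 'I_n) : bool := (i.+1 == j) || (j.+1 == i).

Lemma path_adj_sym : symmetric path_adj.
Proof. by move=> i j; rewrite /path_adj orbC. Qed.

Lemma path_adj_irr : irreflexive path_adj.
Proof. by move=> i; rewrite /path_adj orbb gtn_eqF. Qed.

Definition path_graph : sgraph := SGraph path_adj_sym path_adj_irr.

End PathGraph.

Section CartesianProduct.
Variables G H : sgraph.

Definition cart_adj (x y : (G * H)%type) : bool :=
  (x.1 == y.1) && adj x.2 y.2 || (x.2 == y.2) && adj x.1 y.1.

Lemma cart_adj_sym : symmetric cart_adj.
Proof.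
move=> x y; rewrite /cart_adj (eq_sym x.1) (eq_sym x.2).
by rewrite (adj_sym x.1) (adj_sym x.2).
Qed.

Lemma cart_adj_irr : irreflexive cart_adj.
Proof. by move=> x; rewrite /cart_adj !adj_irr !andbF. Qed.

Definition cart_prod : sgraph := SGraph cart_adj_sym cart_adj_irr.

End CartesianProduct.

(* Main.v *)
Require Import Defs.
From mathcomp Require Import all_boot all_order all_algebra.
From mathcomp Require Import zify ring.

(** For every simple graph [H], the vertices of the line graph of the
    subdivision graph [S(H)] are the flags [(v, e)] of [H], an edge [e]
    together with one of its endpoints [v].  The flag [(v, e)] is adjacent to
    the [d(v) - 1] other flags at [v] and to the unique other flag of [e], so
    its degree is [d(v)].  As [v] carries [d(v)] flags,
    [F(L(S(H)))] is the sum of [d(v) * d(v)^3 = d(v)^4] over the vertices of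
    [H] ([F_index_line_subdivision]).

    Degrees add up in a Cartesian product, and a path on at least two vertices
    has two vertices of degree 1, all others having degree 2.  Hence the grid
    has 4 vertices of degree 2, [2(m - 2) + 2(n - 2)] of degree 3 and
    [(m - 2)(n - 2)] of degree 4, and the sum of the fourth powers is
    [4 * 16 + 2(m + n - 4) * 81 + (m - 2)(n - 2) * 256]. *)

Set Implicit Arguments.
Unset Strict Implicit.
Unset Printing Implicit Defensive.

Import Order.TTheory GRing.Theory Num.Theory.

Section Incidence.
Variable H : sgraph.

Definition incident (v : H) : {set edge H} := [set e : edge H | v \in val e].

Lemma edge_ends (e : edge H) : exists u v : H, adj u v /\ val e = [set u; v].
Proof.
by have := valP e; rewrite inE => /existsP[u /existsP[v /andP[uv /eqP ->]]]; exists u, v.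
Qed.

Lemma set2_edges (u v : H) : adj u v -> [set u; v] \in edges H.
Proof.
by move=> uv; rewrite inE; apply/existsP; exists u; apply/existsP; exists v; rewrite uv eqxx.
Qed.

Lemma adj_neq (u v : H) : adj u v -> u != v.
Proof. by apply: contraTneq => ->; rewrite adj_irr. Qed.

(** An edge at [v] is determined by its other endpoint. *)
Lemma card_incident (v : H) : #|incident v| = degree v.
Proof.
rewrite /degree -(card_imset _ val_inj).
have other_end_inj : {in [set w | adj v w] &, injective (fun w => [set v; w])}.
  move=> w w'; rewrite !inE => /adj_neq vw /adj_neq vw' /setP/(_ w).
  by rewrite !inE eqxx orbT eq_sym (negbTE vw) => /esym/eqP.
rewrite -(card_in_imset other_end_inj); apply: eq_card => s.
apply/imsetP/imsetP => [[e]|[w]]; rewrite inE.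
- have [u [w [uw ->]]] := edge_ends e.
  rewrite !inE => /orP[]/eqP-> ->; [exists w | exists u] => //.
  + by rewrite inE.
  + by rewrite inE adj_sym.
  + by rewrite setUC.
- move=> vw ->; exists (exist (fun s => s \in edges H) _ (set2_edges vw)) => //.
  by rewrite !inE eqxx.
Qed.

(** The neighbours of [uv] are the edges at [u] or at [v], apart from [uv]
    itself, which is the only edge at both; it is thus counted twice on the
    right-hand side and not at all in the degree. *)
Lemma degree_line_graph (e : line_graph H) (u v : H) :
  adj u v -> val e = [set u; v] -> degree e + 2 = degree u + degree v.
Proof.
move=> uv eE; have nuv := adj_neq uv.
rewrite -!card_incident -cardsUI.
have -> : incident u :&: incident v = [set e : edge H].
  apply/setP=> f; rewrite !inE; apply/andP/eqP => [|->]; last by rewrite eE !inE !eqxx orbT.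
  have [x [y [_ fE]]] := edge_ends f.
  rewrite fE !inE => -[ufE vfE]; apply: val_inj; rewrite /= fE eE.
  by move: ufE vfE nuv => /orP[]/eqP-> /orP[]/eqP->; rewrite ?eqxx // setUC.
rewrite (cardsD1 (e : edge H) (incident u :|: incident v)) !inE eE !inE eqxx /=.
rewrite cards1 addnC [RHS]addnAC -[RHS]/(2 + _); congr (_ + _).
apply: eq_card => f; rewrite !inE /= /line_adj eq_sym; congr (_ && _).
apply/existsP/orP => [[w]|].
  by rewrite eE !inE => /andP[/orP[]/eqP->]; [left | right].
by case=> wf; [exists u | exists v]; rewrite eE !inE eqxx ?orbT.
Qed.

End Incidence.

Section Subdivision.
Variable H : sgraph.
Let SH := subdivision_graph H.

Lemma degree_subdivision_inl (v : H) : degree (inl v : SH) = degree v.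
Proof.
rewrite -(card_incident v) /degree -(card_imset _ (@inr_inj H (edge H))).
apply: eq_card => -[w|e]; rewrite !inE /=.
  by apply/esym/imsetP => -[].
by rewrite mem_imset ?inE //; apply: inr_inj.
Qed.

Lemma degree_subdivision_inr (e : edge H) : degree (inr e : SH) = 2.
Proof.
have [u [v [/adj_neq nuv eE]]] := edge_ends e.
have -> : 2 = #|val e| by rewrite eE cards2 nuv.
rewrite /degree -(card_imset _ (@inl_inj H (edge H))).
apply: eq_card => -[w|f]; rewrite !inE /=.
  by rewrite mem_imset //; apply: inl_inj.
by apply/esym/imsetP => -[].
Qed.

Lemma edge_subdivision (f : edge SH) :
  exists (v : H) (e : edge H), adj (inl v : SH) (inr e) /\ val f = [set inl v; inr e].
Proof.
have [[u|d] [[v|e] [// uv ->]]] := edge_ends f; first by exists u, e.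
by exists v, d; rewrite setUC.
Qed.

(** The sum has a single term, the original endpoint of [f].  Writing the
    degree cubed in this form lets the sum over all flags be exchanged with
    the sum over the vertices of [H]. *)
Lemma degree_line_subdivision (f : line_graph SH) :
  degree f ^ 3 = \sum_(v : H | (inl v : SH) \in val f) degree v ^ 3.
Proof.
have [v [e [ve fE]]] := edge_subdivision f.
rewrite (big_pred1 v) => [|w]; last by rewrite fE !inE orbF.
have /addIn -> // : degree f + 2 = degree v + 2.
by rewrite (degree_line_graph ve fE) degree_subdivision_inl degree_subdivision_inr.
Qed.

Lemma F_index_line_subdivision :
  F_index (line_graph SH) = \sum_(v : H) degree v ^ 4.
Proof.
rewrite /F_index (eq_bigr _ (fun f _ => degree_line_subdivision f)).
rewrite (exchange_big_dep predT) //=; apply: eq_bigr => v _.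
rewrite sum_nat_const [RHS]expnS; congr (_ * _).
rewrite -degree_subdivision_inl -card_incident.
by apply: eq_card => f; rewrite !inE.
Qed.

End Subdivision.

(** The neighbours of [(x, y)] split into [{x} x N(y)] and [N(x) x {y}],
    which are disjoint because no vertex is its own neighbour. *)
Lemma degree_cart_prod (G H : sgraph) (p : cart_prod G H) :
  degree p = degree p.1 + degree p.2.
Proof.
case: p => x y /=; rewrite /degree.
set Nx := [set v | adj x v]; set Ny := [set v | adj y v].
have -> : [set q : cart_prod G H | adj ((x, y) : cart_prod G H) q]
          = setX [set x] Ny :|: setX Nx [set y].
  apply/setP => -[a b]; rewrite !inE /= /cart_adj /=.
  by rewrite (eq_sym a) (eq_sym b) [X in _ || X]andbC.
rewrite cardsU !cardsX !cards1 mul1n muln1.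
suff -> : setX [set x] Ny :&: setX Nx [set y] = set0 by rewrite cards0 subn0 addnC.
apply/setP => -[a b]; rewrite !inE /=.
by case: eqP => // ->; rewrite adj_irr andbF.
Qed.

Lemma sum_ord_eq (n k : nat) : \sum_(j < n) (j == k :> nat) = (k < n).
Proof.
case: ltnP => [kn|nk].
  rewrite (bigD1 (Ordinal kn)) //= eqxx big1 // => j.
  by rewrite -val_eqE /= => /negbTE ->.
by rewrite big1 // => j _; rewrite ltn_eqF // (leq_trans (ltn_ord j)).
Qed.

Lemma degree_path_graph (n : nat) (i : path_graph n) :
  degree i = (0 < (i : 'I_n)) + ((i : 'I_n).+1 < n).
Proof.
rewrite /degree -sum1dep_card big_mkcond /=.
transitivity (\sum_(j < n) ((j.+1 == i :> nat) + (j == i.+1 :> nat))).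
  apply: eq_bigr => j _; rewrite /path_adj.
  by move: (nat_of_ord i) (nat_of_ord j) => a b; rewrite (eq_sym b); do 2 case: eqP => //; lia.
rewrite big_split /= sum_ord_eq; congr (_ + _).
case: (nat_of_ord i) (ltn_ord i) => [|k] kn; first by rewrite big1.
by rewrite sum_ord_eq ltnW.
Qed.

(** A path on [n + 2] vertices has two ends and [n] inner vertices. *)
Lemma sum_degree_path_graph (n : nat) (F : nat -> nat) :
  \sum_(i : path_graph n.+2) F (degree i) = 2 * F 1 + n * F 2.
Proof.
rewrite (eq_bigr _ (fun i _ => congr1 F (degree_path_graph i))) /=.
rewrite big_ord_recl big_ord_recr /= !ltnn /=.
rewrite (eq_bigr (fun _ => F 2)) => [|i _]; last first.
  by rewrite /bump /= !add1n !ltnS ltn_ord.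
by rewrite sum_nat_const card_ord add0n addn0; ring.
Qed.

Lemma sum_degree_grid (m n : nat) (F : nat -> nat) :
  \sum_(p : cart_prod (path_graph m.+2) (path_graph n.+2)) F (degree p)
  = 4 * F 2 + 2 * (m + n) * F 3 + m * n * F 4.
Proof.
rewrite (eq_bigr _ (fun p _ => congr1 F (degree_cart_prod p))) /=.
rewrite -(pair_bigA _ (fun (i : path_graph m.+2) (j : path_graph n.+2) =>
  F (degree i + degree j))) /=.
under eq_bigr => i _ do rewrite
  (sum_degree_path_graph n (fun d => F (degree (i : path_graph m.+2) + d))).
rewrite (sum_degree_path_graph m (fun d => 2 * F (d + 1) + n * F (d + 2))).
by rewrite /=; ring.
Qed.

Local Open Scope ring_scope.

Theorem theorem11 (m n : nat) (hm : (2 <= m)%N) (hn : (2 <= n)%N) :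
  (F_index (line_graph (subdivision_graph
     (cart_prod (path_graph m) (path_graph n)))))%:Z
  = 256%:Z * m%:Z * n%:Z - 350%:Z * m%:Z - 350%:Z * n%:Z + 440%:Z.
Proof.
case: m n hm hn => [|[|m]] // [|[|n]] // _ _.
rewrite F_index_line_subdivision (sum_degree_grid m n (fun d => d ^ 4)%N).
lia.
Qed.
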